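(* Let $G$ be a finite group and suppose $G=G_1G_2\cdots G_n$, where $G_1,\dots,G_n$ are subgroups of $G$ that are pairwise permutable (i.e. $G_iG_j=G_jG_i$ for all $i,j$) and pairwise $\mathfrak{N}$-connected. Then $$\Gamma_s(G)=\bigcup_{i=1}^n\Gamma_s(G_i),\qquad \Gamma_H(G)=\bigcup_{i=1}^n\Gamma_H(G_i),\qquad \Gamma_{Nc}(G)=\bigcup_{i=1}^n\Gamma_{Nc}(G_i).$$
   Context: All groups are finite; $\pi(G)$ denotes the set of prime divisors of $|G|$, and $\pi(n)$ the set of prime divisors of an integer $n$. Graphs are directed: a graph $\Gamma$ consists of a vertex set $V(\Gamma)$ and an edge set $E(\Gamma)$ of ordered pairs of vertices (loops allowed). The union $\Gamma_1\cup\Gamma_2$ has vertex set $V(\Gamma_1)\cup V(\Gamma_2)$ and edge set $E(\Gamma_1)\cup E(\Gamma_2)$; equality of graphs means equality of vertex sets and edge sets. $O_{p',p}(G)$ is the largest normal $p$-nilpotent subgroup of $G$, i.e. $O_{p',p}(G)/O_{p'}(G)=O_p(G/O_{p'}(G))$. The Hawkes graph $\Gamma_H(G)$ has vertex set $\pi(G)$ and an edge $(p,q)$ whenever $q\in\pi(G/O_{p',p}(G))$. The Sylow graph $\Gamma_s(G)$ has vertex set $\pi(G)$ and an edge $(p,q)$ whenever $q\in\pi(N_G(P)/PC_G(P))$ for some Sylow $p$-subgroup $P$ of $G$. A Schmidt group is a non-nilpotent group all of whose proper subgroups are nilpotent; a Schmidt $(p,q)$-group is a Schmidt group $S$ with $\pi(S)=\{p,q\}$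 and a normal Sylow $p$-subgroup. The $N$-critical graph $\Gamma_{Nc}(G)$ has vertex set $\pi(G)$ and an edge $(p,q)$ whenever $G$ contains a Schmidt $(p,q)$-subgroup. Subgroups $H,K$ of $G$ are $\mathfrak{N}$-connected if $\langle x,y\rangle$ is nilpotent for every $x\in H$, $y\in K$. *)

(* Defs.v *)
From mathcomp Require Import all_boot all_fingroup all_solvable.
Set Implicit Arguments. Unset Strict Implicit. Unset Printing Implicit Defensive.
Local Open Scope group_scope.

Record graph := Graph { vert : nat -> Prop; edge : nat -> nat -> Prop }.

Definition graph_eq (A B : graph) : Prop :=
  (forall p, vert A p <-> vert B p) /\ (forall p q, edge A p q <-> edge B p q).

Definition graph_bigU (n : nat) (F : 'I_n -> graph) : graph :=
  Graph (fun p => exists i, vert (F i) p) (fun p q => exists i, edge (F i) p q).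

Section Graphs.
Variable gT : finGroupType.

Definition hawkes_graph (G : {group gT}) : graph :=
  Graph (fun p => p \in \pi(G))
        (fun p q => p \in \pi(G) /\ q \in \pi(G / 'O_{p^', p}(G))).

Definition sylow_graph (G : {group gT}) : graph :=
  Graph (fun p => p \in \pi(G))
        (fun p q => p \in \pi(G) /\
           exists P : {group gT}, P \in 'Syl_p(G) /\
             q \in \pi('N_G(P) / (P <*> 'C_G(P)))).

Definition schmidt (S : {group gT}) : Prop :=
  ~~ nilpotent S /\ forall H : {group gT}, H \proper S -> nilpotent H.

Definition schmidt_pq (p q : nat) (S : {group gT}) : Prop :=
  schmidt S /\ (forall r, r \in \pi(S) <-> (r = p \/ r = q)) /\
  exists P : {group gT}, P \in 'Syl_p(S) /\ P <| S.

Definition ncrit_graph (G : {group gT}) : graph :=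
  Graph (fun p => p \in \pi(G))
        (fun p q => exists S : {group gT}, S \subset G /\ schmidt_pq p q S).

Definition N_connected (H K : {group gT}) : Prop :=
  forall x y, x \in H -> y \in K -> nilpotent <<[set x; y]>>.

End Graphs.

(* Main.v *)
Require Import Defs.
From mathcomp Require Import all_boot all_fingroup all_solvable.
Set Implicit Arguments. Unset Strict Implicit. Unset Printing Implicit Defensive.
Local Open Scope group_scope.

(** Write S_p(X) for the subgroup of X generated by its p-elements and R_p(X)
    for the one generated by its p'-elements.  For N-connected A and B, S_p(A)
    centralises R_p(B) and R_p(A) centralises S_p(B), for every p; in this form
    connectedness passes to the product of two permutable factors, so everything
    reduces to G = AB.  Then D = [A, B] is contained in [R_p(A), R_p(B)]
    [S_p(A), S_p(B)], where the first factor is centralised by S_p(G) and the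
    second is a p-group.  Hence p-elements of G centralise p'-elements of D, so
    coprime actions cannot see D; and G / D is a central product of the images of
    A and B.  An edge of any of the three graphs of G is a failure of
    centralisation: of a p-subgroup (a Sylow one for the Sylow graph) by a q-element
    normalising it, or, for the Hawkes graph, of R_p(S_q(G)) to be a p'-group.
    Such a failure already shows up modulo AD or modulo BD, that is, in a quotient
    of B or of A, from which it lifts by a Frattini argument. *)

(* In the usual notation this is O^{pi'}(G). *)
Definition pgen (pi : nat_pred) (gT : finGroupType) (G : {set gT}) : {set gT} :=
  <<[set x in G | pi.-elt x]>>.
Canonical pgen_group pi gT G := Eval hnf in [group of @pgen pi gT G].

(** * Subgroups generated by [pi]-elements *)

Section PGen.
Variable gT : finGroupType.
Implicit Types (pi : nat_pred) (A B G H K N P : {group gT}) (x : gT).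

Lemma mem_pgen pi G x : x \in G -> pi.-elt x -> x \in pgen pi G.
Proof. by move=> Gx pix; rewrite mem_gen // inE Gx. Qed.

Lemma pgen_subP pi G H :
  reflect {in G, forall x, pi.-elt x -> x \in H} (pgen pi G \subset H).
Proof.
rewrite gen_subG; apply: (iffP subsetP) => [sH x Gx pix | sH x].
  by apply: sH; rewrite inE Gx.
by rewrite inE => /andP[]; apply: sH.
Qed.

Lemma pgen_sub pi G : pgen pi G \subset G.
Proof. exact/pgen_subP. Qed.

Lemma pgenS pi A G : A \subset G -> pgen pi A \subset pgen pi G.
Proof.
by move/subsetP=> sAG; apply/pgen_subP=> x Ax; apply/mem_pgen/sAG.
Qed.

Lemma pgroup_sub_pgen pi P G : P \subset G -> pi.-group P -> P \subset pgen pi G.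
Proof.
move=> /subsetP sPG piP; apply/subsetP=> x Px.
by rewrite mem_pgen ?sPG ?(mem_p_elt piP).
Qed.

Lemma norms_pgen pi A G : A \subset 'N(G) -> A \subset 'N(pgen pi G).
Proof.
move/subsetP=> nGA; apply/norms_gen/subsetP=> a /nGA nGa.
rewrite inE; apply/subsetP=> _ /imsetP[x + ->]; rewrite !inE p_eltJ.
by case/andP=> Gx ->; rewrite memJ_norm ?Gx.
Qed.

Lemma pgen_normal pi G : pgen pi G <| G.
Proof. by rewrite /normal pgen_sub norms_pgen ?normG. Qed.

End PGen.

(** * Generation by [pi]-elements and quotients *)

Section PGenQuotient.
Variable gT : finGroupType.
Implicit Types (pi : nat_pred) (A B G H K N P : {group gT}) (x : gT).

Lemma coset_constt pi K x :
  x \in 'N(K) -> pi.-elt (coset K x) -> coset K x.`_pi = coset K x.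
Proof. by move=> nKx pix; rewrite morph_constt ?constt_p_elt. Qed.

Lemma quotient_pgen pi G K : G \subset 'N(K) -> pgen pi (G / K) = pgen pi G / K.
Proof.
move=> nKG; apply/eqP; rewrite eqEsubset; apply/andP; split.
  apply/pgen_subP=> _ /morphimP[x nKx Gx ->] pix.
  rewrite /= -(coset_constt nKx pix); apply: mem_morphim.
    exact: groupX.
  by apply: mem_pgen; [apply: groupX | apply: p_elt_constt].
rewrite /pgen /quotient morphim_gen /=; last first.
  by apply: subset_trans nKG; apply/subsetP=> x; rewrite inE => /andP[].
rewrite genS //; apply/subsetP=> _ /morphimP[x nKx + ->].
by rewrite !inE => /andP[Gx pix]; rewrite mem_quotient // morph_p_elt.
Qed.

(** The coset of a [pi]-element is both a [pi]- and a [pi^']-element. With its converse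
    [pquotient_pgen], this makes [pgen pi G] the smallest normal subgroup of [G] with
    [pi^']-quotient. *)
Lemma pgen_sub_pquotient pi G N :
  G \subset 'N(N) -> pi^'.-group (G / N) -> pgen pi G \subset N.
Proof.
move=> nNG pi'GN; apply/pgen_subP=> x Gx pix.
have nNx := subsetP nNG x Gx; rewrite coset_idr //.
have pixN: pi.-elt (coset N x) by rewrite morph_p_elt.
have pi'xN: pi^'.-elt (coset N x) by rewrite (mem_p_elt pi'GN) ?mem_quotient.
by rewrite -(constt_p_elt pixN) (constt1P pi'xN).
Qed.

Lemma pquotient_pgen pi G N :
  G \subset 'N(N) -> pgen pi G \subset N -> pi^'.-group (G / N).
Proof.
move=> nNG sN; apply/pgroupP=> r r_pr /Cauchy[] // y GNy oy.
apply/negP=> pi_r; have ry: pi.-elt y by rewrite /p_elt oy pnatE.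
have: y \in pgen pi (G / N) by apply: mem_pgen.
rewrite quotient_pgen // => /(subsetP (quotientS N sN)).
rewrite trivg_quotient => /set1gP y1.
by move: oy r_pr; rewrite y1 order1 => <-.
Qed.

Lemma pgen_mul pi G : pgen pi G * pgen pi^' G = G.
Proof.
apply/eqP; rewrite eqEsubset mul_subG ?pgen_sub //=; apply/subsetP=> x Gx.
by rewrite -(consttC pi x) mem_mulg ?mem_pgen ?groupX ?p_elt_constt.
Qed.

(** A cyclic group is generated by its Sylow subgroups, and those of [<[x]>] for primes outside [pi]
    are trivial. *)
Lemma pgen_sub_prime pi G H :
    (forall q x, prime q -> q \in pi -> x \in G -> q.-elt x -> x \in H) ->
  pgen pi G \subset H.
Proof.
move=> sH; apply/pgen_subP=> x Gx pix; rewrite -cycle_subG -(Sylow_gen <[x]>) gen_subG.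
apply/bigcupsP=> Q /SylowP[q q_pr sylQ]; apply/subsetP=> y Qy.
have xy: y \in <[x]> := subsetP (pHall_sub sylQ) y Qy.
have qy: q.-elt y := mem_p_elt (pHall_pgroup sylQ) Qy.
have Gy: y \in G by rewrite (subsetP _ y xy) ?cycle_subG.
have [pi_q | pi'q] := boolP (q \in pi); first exact: sH Gy qy.
have piy: pi.-elt y by apply: mem_p_elt xy.
suffices ->: y = 1 by [].
by rewrite -(constt_p_elt piy) (constt1P (sub_p_elt _ qy)) // => r /eqP->.
Qed.

End PGenQuotient.

Lemma pgenNK pi gT (G : {group gT}) : pgen pi^'^' G = pgen pi G.
Proof. by congr <<_>>; apply/setP=> x; rewrite !inE p_eltNK. Qed.

(* Unlike the elementwise [N_connected], this passes to products. *)
Definition pconnected (gT : finGroupType) (A B : {set gT}) : Prop :=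
  forall p : nat,
    pgen p A \subset 'C(pgen p^' B) /\ pgen p^' A \subset 'C(pgen p B).

(** * Connected factors and their commutator *)

Section PConnected.
Variable gT : finGroupType.
Implicit Types (pi : nat_pred) (A B G H K N P : {group gT}) (x : gT).

Lemma pconnected_sym A B : pconnected A B -> pconnected B A.
Proof. by move=> cAB p; have [cAB1 cAB2] := cAB p; split; rewrite centsC. Qed.

(** Elements of coprime orders commute in the nilpotent group that [x] and [y] generate. *)
Lemma N_connected_pconnected A B : N_connected A B -> pconnected A B.
Proof.
move=> nilAB p.
have comm pi x y : x \in A -> y \in B -> pi.-elt x -> pi^'.-elt y -> commute x y.
  move=> Ax By pix pi'y; apply/cent1P; rewrite -cent_cycle -cycle_subG.
  apply: (sub_nilpotent_cent2 (nilAB x y Ax By)); rewrite ?cycle_subG.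
  - by rewrite mem_gen // !inE eqxx orbT.
  - by rewrite mem_gen // !inE eqxx.
  by rewrite coprime_sym; apply: (@pnat_coprime pi); rewrite -/(p_elt _ _).
split; rewrite gen_subG centsC gen_subG; apply/centsP=> y + x; rewrite !inE.
  by case/andP=> By p'y /andP[Ax px]; apply/commute_sym/(comm p).
by case/andP=> By py /andP[Ax p'x]; apply/commute_sym/(comm p^'); rewrite ?p_eltNK.
Qed.

Lemma norm_pgenY pi A B :
  pgen pi^' A \subset 'C(pgen pi B) -> A \subset 'N(pgen pi A <*> pgen pi B).
Proof.
move=> cAB; rewrite -{1}(pgen_mul pi A) mul_subG //.
  exact: subset_trans (joing_subl _ _) (normG _).
apply: normsY; last exact: cents_norm.
exact: subset_trans (pgen_sub _ _) (normal_norm (pgen_normal _ _)).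
Qed.

Lemma mulg_comm A B G : A * B = G -> B * A = G.
Proof.
move=> defG; have /comm_group_setP cAB: group_set (A * B) by rewrite defG groupP.
by rewrite -defG cAB.
Qed.

(** Both factors normalise [M], and modulo [M] each is a [pi^']-group, hence so is their product. *)
Lemma pgen_mulG pi A B G :
    A * B = G -> pgen pi A \subset 'C(pgen pi^' B) ->
    pgen pi^' A \subset 'C(pgen pi B) ->
  pgen pi G = pgen pi A <*> pgen pi B.
Proof.
move=> defG cAB1 cAB2; set M := _ <*> _.
have [sAG sBG]: A \subset G /\ B \subset G by apply: mulG_sub.
have nMA: A \subset 'N(M) by apply: norm_pgenY.
have nMB: B \subset 'N(M) by rewrite /M joingC norm_pgenY // centsC.
apply/eqP; rewrite eqEsubset join_subG.
rewrite !pgenS // !andbT.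
apply: pgen_sub_pquotient; rewrite -defG ?mul_subG // quotientMl // pgroupM.
by rewrite !pquotient_pgen ?joing_subl ?joing_subr.
Qed.

Lemma pconnected_mul A B C G :
    A * B = G -> pconnected A B -> pconnected A C -> pconnected B C ->
  pconnected G C.
Proof.
move=> defG cAB cAC cBC p.
have [[cAB1 cAB2] [cAC1 cAC2] [cBC1 cBC2]] := And3 (cAB p) (cAC p) (cBC p).
have -> := pgen_mulG defG cAB1 cAB2.
have -> := @pgen_mulG p^' A B G defG; rewrite ?pgenNK // !join_subG.
by rewrite cAC1 cAC2 cBC1 cBC2.
Qed.

(** Three subgroups lemma: [pgen pi A] centralises [pgen pi^' B], and so does its commutator with
    [pgen pi^' A], which stays inside the normal subgroup [pgen pi A]. *)
Lemma cent_comm_pgen pi A B :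
    pgen pi A \subset 'C(pgen pi^' B) ->
  pgen pi A \subset 'C([~: pgen pi^' A, pgen pi^' B]).
Proof.
move=> cAB; rewrite centsC; apply/commG1P; apply: three_subgroup.
  by have /commG1P -> : pgen pi^' B \subset 'C(pgen pi A); rewrite ?comm1G // centsC.
apply/commG1P/(subset_trans _ cAB).
rewrite commg_subl (subset_trans (pgen_sub _ _)) //.
exact: normal_norm (pgen_normal _ _).
Qed.

Lemma norm_comm_pgen pi A B :
    pgen pi A \subset 'C(pgen pi^' B) ->
  A \subset 'N([~: pgen pi^' A, pgen pi^' B]).
Proof.
move=> cAB; rewrite -{1}(pgen_mul pi A) mul_subG ?commg_norml //.
by rewrite cents_norm ?cent_comm_pgen.
Qed.

Lemma Sylow_mulG_sub (p : nat) A B G :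
  A * B = G -> exists P Q R : {group gT},
    [/\ p.-Sylow(A) P, p.-Sylow(B) Q, p.-Sylow(G) R, P \subset R & Q \subset R].
Proof.
move=> defG; have [P sylP] := Sylow_exists p A; have [Q sylQ] := Sylow_exists p B.
have [sAG sBG]: A \subset G /\ B \subset G by apply: mulG_sub.
have [sPG sQG] := (subset_trans (pHall_sub sylP) sAG, subset_trans (pHall_sub sylQ) sBG).
have [R sylR sPR] := Sylow_superset sPG (pHall_pgroup sylP).
have [g Gg sQgR] := Sylow_Jsub sylR sQG (pHall_pgroup sylQ).
(* Splitting the conjugator as [b * a] means that [P] is moved only by an element of [A] and [Q]
   only by one of [B]; both then lie in [R :^ a^-1]. *)
have /mulsgP[b a Bb Aa def_g]: g \in B * A by rewrite (mulg_comm defG).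
exists (P :^ a^-1)%G, (Q :^ b)%G, (R :^ a^-1)%G; split.
- by rewrite /= pHallJ ?groupV.
- by rewrite /= pHallJ.
- by rewrite /= pHallJ ?groupV ?(subsetP sAG).
- by rewrite /= conjSg.
by rewrite /= -sub_conjg -conjsgM -def_g.
Qed.

Lemma pgen_mul_Sylow (p : nat) P G : p.-Sylow(G) P -> pgen p^' G * P = G.
Proof.
move=> sylP; have [sPG pP _] := and3P sylP.
have nT := normal_norm (pgen_normal p^' G).
apply/eqP; rewrite eqEsubset mul_subG ?pgen_sub //= -quotientSK //.
rewrite (pHall_id (quotient_pHall (subset_trans sPG nT) sylP)) //.
by rewrite -pgroupNK pquotient_pgen.
Qed.

(** Write [x = t * u] and [y = s * v], with [u], [v] in Sylow [p]-subgroups of [A], [B] and [t], [s]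
    generated by [p^']-elements. Connectedness removes [t] and [s], so [[~ x, y] = [~ u, v]] lies in
    one Sylow [p]-subgroup of [G]. *)
Lemma pgroup_comm_pgen (p : nat) A B G :
    A * B = G -> pconnected A B -> p.-group [~: pgen p A, pgen p B].
Proof.
move=> defG cAB; have [cAB1 cAB2] := cAB p.
have [P [Q [R [sylP sylQ sylR sPR sQR]]]] := Sylow_mulG_sub p defG.
apply: pgroupS (pHall_pgroup sylR); rewrite gen_subG.
apply/subsetP=> _ /imset2P[x y Sx Sy ->].
have decomp (X Y : {group gT}) z : p.-Sylow(X) Y -> z \in pgen p X ->
    exists t y, [/\ t \in pgen p^' X, y \in Y & z = t * y].
  move=> sylY Sz; have /mulsgP[t u Tt Yu ->]: z \in pgen p^' X * Y.
    by rewrite pgen_mul_Sylow ?(subsetP (pgen_sub p X)).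
  by exists t, u.
have [t [u [Tt Pu def_x]]] := decomp A P x sylP Sx.
have [s [v [Ts Qv def_y]]] := decomp B Q y sylQ Sy.
have Su: u \in pgen p A.
  by rewrite (subsetP (pgroup_sub_pgen (pHall_sub sylP) (pHall_pgroup sylP))).
have /commgP/eqP cty: commute t y := centsP cAB2 t Tt y Sy.
have /commgP/eqP cus: commute u s := centsP cAB1 u Su s Ts.
rewrite def_x commMgJ cty conj1g mul1g def_y commgMJ cus.
by rewrite conj1g mulg1 groupR ?(subsetP sPR u) ?(subsetP sQR v).
Qed.

(** The commutator lies in [M = U * E], where [U] centralises [pgen q G] and [E] is a [q]-group
    normalising [U]. As [M / U] is a [q]-group, the [q^']-elements fall into [U]. *)
Lemma cent_comm_pconnected (q : nat) A B G :
    A * B = G -> pconnected A B ->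
  pgen q^' [~: A, B] \subset 'C(pgen q G).
Proof.
move=> defG cAB; have [cAB1 cAB2] := cAB q.
pose U := [~: pgen q^' A, pgen q^' B]%G; pose E := [~: pgen q A, pgen q B]%G.
have cBA1: pgen q B \subset 'C(pgen q^' A) by rewrite centsC.
have cBA2: pgen q^' B \subset 'C(pgen q A) by rewrite centsC.
have [nUA nUB]: A \subset 'N(U) /\ B \subset 'N(U).
  by split; last rewrite /= commGC; apply: norm_comm_pgen.
have [nEA nEB]: A \subset 'N(E) /\ B \subset 'N(E).
  split; rewrite /= -(pgenNK q A) -(pgenNK q B).
    by rewrite norm_comm_pgen // pgenNK.
  by rewrite commGC norm_comm_pgen // pgenNK.
have cUG: U \subset 'C(pgen q G).
  rewrite (pgen_mulG defG cAB1 cAB2) centsC join_subG cent_comm_pgen //=.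
  by rewrite commGC cent_comm_pgen.
have qE: q.-group E by apply: pgroup_comm_pgen defG cAB.
pose M := (U <*> E)%G.
have [nMA nMB]: A \subset 'N(M) /\ B \subset 'N(M) by rewrite !normsY.
have sDM: [~: A, B] \subset M.
  have [sUM sEM]: U \subset M /\ E \subset M by rewrite joing_subl joing_subr.
  rewrite -quotient_cents2 //.
  (* Of the four pairs of factors, the like ones commute modulo [M] because it contains [U] and [E],
     the mixed ones by connectedness. *)
  rewrite -{1}(pgen_mul q A) -{1}(pgen_mul q B) !quotientMl //; last first.
  - by rewrite (subset_trans (pgen_sub _ _)).
  - by rewrite (subset_trans (pgen_sub _ _)).
  rewrite centM subsetI !mul_subG //.
  - exact: quotient_cents.
  - exact: quotient_cents2r.
  - exact: quotient_cents2r.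
  exact: quotient_cents.
apply: subset_trans (pgenS _ sDM) (subset_trans _ cUG).
have nUE: E \subset 'N(U) by rewrite comm_subG ?(subset_trans (pgen_sub _ _)).
have nUM: M \subset 'N(U) by rewrite join_subG normG.
apply: pgen_sub_pquotient => //.
by rewrite /= norm_joinEr // quotientMidl pgroupNK quotient_pgroup.
Qed.

End PConnected.

(** * Coprime action *)

Lemma coprime_stable_cent (gT : finGroupType) (A G H : {group gT}) :
    coprime #|G| #|A| -> solvable G -> H <| G -> [~: G, A] \subset H ->
    A \subset 'C(H) ->
  A \subset 'C(G).
Proof.
move=> coGA solG /andP[sHG nHG] sGAH cHA.
have nHA: A \subset 'N(H) by apply: cents_norm.
have sCA: 'C_G(A) \subset 'C(A) by apply: subsetIr.
have cAGH: G / H \subset 'C(A / H) by rewrite quotient_cents2.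
(* By coprimality the fixed points of [A] on [G / H], which are all of it, lift to ['C_G(A)]. *)
rewrite centsC (subset_trans (_ : G \subset H * 'C_G(A))) //.
  rewrite -quotientSK // coprime_quotient_cent //.
  by rewrite subsetI subxx.
by rewrite mul_subG // centsC.
Qed.

(** With [X = [~: P, <[g]>]], the group [[~: X, <[g]>]] lies in [W :&: P] and is centralised by [g];
    coprime stability, used twice, carries this up to [X] and then to [P]. *)
Lemma stable_chain_cent (gT : finGroupType) (p : nat) (P V W : {group gT}) g :
    p.-group P -> p^'.-elt g -> g \in 'N(P) ->
    [~: P, <[g]>] \subset V -> [~: V, <[g]>] \subset W ->
    W :&: P \subset 'C(<[g]>) -> g \in 'C(P).
Proof.
move=> pP p'g nPg sXV sVW cWg; pose X := [~: P, <[g]>]%G.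
have nP: <[g]> \subset 'N(P) by rewrite cycle_subG.
have sXP: X \subset P by rewrite commg_subl.
have co (H : {group gT}) : H \subset P -> coprime #|H| #|<[g]>|.
  by move=> sHP; have pH := pgroupS sHP pP; apply: (pnat_coprime pH).
have sXgW: [~: X, <[g]>] \subset W by apply: subset_trans (commSg _ sXV) sVW.
have sXgX: [~: X, <[g]>] \subset X by rewrite commg_subl commg_normr.
have solP := nilpotent_sol (pgroup_nil pP).
have sol (H : {group gT}) : H \subset P -> solvable H by move=> sHP; apply: solvableS solP.
have cYg: <[g]> \subset 'C([~: X, <[g]>]).
  by rewrite centsC (subset_trans _ cWg) // subsetI sXgW (subset_trans sXgX).
have cXg: <[g]> \subset 'C(X).
  apply: (coprime_stable_cent (H := [~: X, <[g]>]%G)); rewrite ?co ?sol //.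
  by rewrite /normal sXgX commg_norml.
rewrite -cycle_subG; apply: (coprime_stable_cent (H := X)); rewrite ?co ?sol //.
by rewrite /normal sXP commg_norml.
Qed.

(** * Normal closures of the factors, and lifting actions to a factor *)

Section Product.
Variable gT : finGroupType.
Implicit Types A B G K P : {group gT}.

Lemma mulG_supplement A B G K :
  A * B = G -> B \subset K -> K \subset G -> A * K = G.
Proof.
move=> defG sBK sKG; have [sAG _] := mulG_sub defG.
by apply/eqP; rewrite eqEsubset mul_subG //= -{1}defG mulgS.
Qed.

Lemma norm_joing_comm A B : B \subset 'N(A <*> [~: A, B]).
Proof.
apply/subsetP=> y By; rewrite inE conjYg join_subG (normsP (commg_normr _ _)) //.
rewrite joing_subr andbT; apply/subsetP=> _ /imsetP[x Ax ->].
rewrite conjg_mulR groupM //; first by rewrite mem_gen // inE Ax.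
by rewrite mem_gen // inE mem_commg ?orbT.
Qed.

(** This is the normal closure of [A] in [G]; [B] normalises it because [x ^ y = x * [~ x, y]]. *)
Lemma joing_comm_normal A B G : A * B = G -> A <*> [~: A, B] <| G.
Proof.
move=> defG; have [sAG sBG]: A \subset G /\ B \subset G.
  by apply: mulG_sub.
rewrite /normal join_subG sAG (subset_trans (commgSS sAG sBG)) ?commg_subl ?normG //=.
rewrite -{1}defG mul_subG ?norm_joing_comm //.
by rewrite (subset_trans (joing_subl A [~: A, B])) ?normG.
Qed.

(** Modulo [D] the images of [A] and [B] centralise each other, and the intersection lies in both,
    so it is central. *)
Lemma comm_joing_capI A B G :
    A * B = G ->
  [~: (A <*> [~: A, B]) :&: (B <*> [~: A, B]), G] \subset [~: A, B].
Proof.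
move=> defG; set D := [~: A, B]; set Z := _ :&: _.
have [nDA nDB]: A \subset 'N(D) /\ B \subset 'N(D).
  by rewrite commg_norml commg_normr.
have nDG: G \subset 'N(D) by rewrite -defG mul_subG.
have cAB: A / D \subset 'C(B / D) by rewrite quotient_cents2.
have nDZ: Z \subset 'N(D) by rewrite subIset // join_subG nDA normG.
rewrite -quotient_cents2 // -defG quotientMl // centM subsetI; apply/andP; split.
  apply: subset_trans (quotientS _ (subsetIr _ _)) _.
  by rewrite quotientYidr // centsC.
apply: subset_trans (quotientS _ (subsetIl _ _)) _.
by rewrite quotientYidr.
Qed.

(* Frattini argument: an action of a [q]-element on a [p]-subgroup which is
   nontrivial modulo [K] comes from one inside a supplement of [K]. *)
Lemma lift_action A K G P (p q : nat) g :
    A * K = G -> K <| G -> P \subset G -> p.-group P ->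
    g \in 'N_G(P) -> q.-elt g -> ~~ ([~: P, <[g]>] \subset K) ->
  exists P1 : {group gT}, exists g1,
    [/\ P1 \subset A, p.-group P1, p.-Sylow(G) P -> p.-Sylow(A) P1,
        g1 \in 'N_A(P1) & q.-elt g1 /\ g1 \notin 'C(P1)].
Proof.
move=> defG nsKG sPG pP /setIP[Gg nPg] qg nsPgK.
have [sKG nKG] := andP nsKG.
have [sAG _] := mulG_sub defG.
have nKP := subset_trans sPG nKG; have nKA := subset_trans sAG nKG.
have sPKG: P * K \subset G by rewrite mul_subG.
pose M := (P <*> K)%G; have defM: M :=: P * K by rewrite /= norm_joinEl.
(* By Dedekind's law [N] supplements [K] in [M], so a Sylow [p]-subgroup of [N] has the same image
   modulo [K] as [P]. *)
pose N := (A :&: M)%G.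
have defNK: N * K = M.
  rewrite /= setIC group_modr ?joing_subr // defG; apply/setIidPl.
  by rewrite -/M defM.
have [P1 sylP1] := Sylow_exists p N.
have [sP1N pP1 _] := and3P sylP1.
have sP1A: P1 \subset A := subset_trans sP1N (subsetIl _ _).
have quoN: N / K = P / K by rewrite -quotientMidr defNK defM quotientMidr.
have pNK: p.-group (N / K) by rewrite quoN quotient_pgroup.
have quoP1: P1 / K = P / K.
  rewrite -quoN; apply: pHall_id pNK.
  by rewrite quotient_pHall ?(subset_trans sP1A).
have sMN: M \subset 'N(K) by rewrite join_subG nKP normG.
have nMg: g \in 'N(M).
  by rewrite -cycle_subG normsY ?cycle_subG ?(subsetP nKG).
have /mulsgP[a k Aa Kk def_g]: g \in A * K by rewrite defG.
have nMa: a \in 'N(M).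
  have ->: a = g * k^-1 by rewrite def_g mulgK.
  by rewrite groupM ?groupV // (subsetP (normG M)) ?(subsetP (joing_subr P K)).
have nsNY: N <| 'N_A(M).
  by rewrite /normal subsetI subsetIl normsGI ?subsetIr // subIset ?normG ?orbT.
(* The Frattini argument gives [a = n * m] with [m] normalising [P1]. Modulo [K], [n] agrees with
   some [x] in [P1], so [y = x * m] normalises [P1] and has the same coset as [g]. *)
have: a \in 'N_A(M) by rewrite inE Aa.
rewrite -(Frattini_arg nsNY sylP1) => /mulsgP[n m Nn /setIP[/setIP[Am _] nP1m] def_a].
have nKn: n \in 'N(K) by rewrite (subsetP nKA) //; case/setIP: Nn.
have /morphimP[x nKx P1x def_xK]: coset K n \in P1 / K.
  by rewrite quoP1 -quoN mem_quotient.
have Ax := subsetP sP1A x P1x; have nKm := subsetP nKA m Am.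
have nKk: k \in 'N(K) := subsetP (normG K) k Kk.
pose y := x * m; have Ay: y \in A by rewrite groupM.
have nKy := subsetP nKA y Ay.
have yK: coset K y = coset K g.
  rewrite def_g def_a !morphM ?groupM //= -def_xK [coset K k]coset_id // mulg1.
  by [].
have nP1y: y \in 'N(P1) by rewrite groupM // (subsetP (normG P1)).
have y1K: coset K y.`_q = coset K g.
  rewrite (coset_constt nKy) yK //.
  by rewrite morph_p_elt // (subsetP nKG).
exists P1, y.`_q; split=> //; last 2 first.
- by rewrite inE !groupX.
- split; first exact: p_elt_constt.
  apply: contra nsPgK => cP1y; rewrite -quotient_cents2 ?cycle_subG ?(subsetP nKG) //.
  rewrite -quoP1 quotient_cycle ?(subsetP nKG) // -y1K.
  by rewrite -quotient_cycle ?groupX // quotient_cents // centsC cycle_subG.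
(* Modulo [K], [P2] contains the image of [P], a Sylow subgroup of [G / K]. The images agree, so
   [P2] lies in [N] and equals [P1]. *)
move=> sylP; have [P2 sylP2 sP12] := Sylow_superset sP1A pP1.
have [sP2A pP2 _] := and3P sylP2; have nKP2 := subset_trans sP2A nKA.
suffices <-: P2 :=: P1 by [].
apply: (sub_pHall sylP1 pP2 sP12); rewrite subsetI sP2A /= norm_joinEl //.
rewrite (normC nKP) -quotientSK //.
have -> : P2 / K = P / K; last by [].
apply: (sub_pHall (quotient_pHall nKP sylP)); rewrite ?quotient_pgroup //.
  by rewrite /= -quoP1 quotientS.
by rewrite quotientS // (subset_trans sP2A).
Qed.

End Product.

(** * Actions of [q]-elements on [p]-subgroups of a product *)

Definition pq_action (p q : nat) (gT : finGroupType) (G P : {group gT}) (g : gT) :=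
  [/\ P \subset G, p.-group P, g \in 'N_G(P), q.-elt g & g \notin 'C(P)].

Section Actions.
Variable gT : finGroupType.
Implicit Types (A B G H K N P S : {group gT}) (p q : nat).

Lemma neq_pgroup p q P : p != q -> p.-group P -> q^'.-group P.
Proof. by move=> npq; apply: sub_pgroup => r /eqP->. Qed.

(** If [[~: P, <[g]>]] escapes [L] or [K], the action lifts to [A] or [B]. Otherwise it lies in
    [K :&: L], whose commutator with [g] is in [D]; as [g] centralises [D :&: P], it would
    centralise [P]. *)
Lemma pq_action_mulG p q A B G P g :
    p != q -> A * B = G -> pconnected A B -> pq_action p q G P g ->
  exists P1 : {group gT}, exists g1,
    (pq_action p q A P1 g1 /\ (p.-Sylow(G) P -> p.-Sylow(A) P1)) \/
    (pq_action p q B P1 g1 /\ (p.-Sylow(G) P -> p.-Sylow(B) P1)).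
Proof.
move=> npq defG cAB [sPG pP Ng qg ncPg].
have defG' := mulg_comm defG; have [sAG sBG] := mulG_sub defG.
pose K := (A <*> [~: A, B])%G; pose L := (B <*> [~: A, B])%G.
have nsKG: K <| G by apply: joing_comm_normal.
have nsLG: L <| G by rewrite /L commGC; apply: joing_comm_normal.
have [sPgL | nsPgL] := boolP ([~: P, <[g]>] \subset L); last first.
  have defAL: A * L = G by rewrite (mulG_supplement defG) ?joing_subl ?normal_sub.
  have [P1 [g1 [sP1A pP1 syl1 Ng1 [qg1 nc1]]]] :=
    lift_action defAL nsLG sPG pP Ng qg nsPgL.
  by exists P1, g1; left.
have [sPgK | nsPgK] := boolP ([~: P, <[g]>] \subset K); last first.
  have defBK: B * K = G by rewrite (mulG_supplement defG') ?joing_subl ?normal_sub.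
  have [P1 [g1 [sP1B pP1 syl1 Ng1 [qg1 nc1]]]] :=
    lift_action defBK nsKG sPG pP Ng qg nsPgK.
  by exists P1, g1; right.
case/negP: ncPg; have [Gg nPg] := setIP Ng.
pose D := [~: A, B]%G.
apply: (@stable_chain_cent _ p P (K :&: L)%G D g) => //.
- by apply: sub_p_elt qg => r /eqP->; rewrite !inE eq_sym.
- by rewrite subsetI sPgK.
- by apply: subset_trans (comm_joing_capI defG); rewrite commgS ?cycle_subG.
have sDP: D :&: P \subset pgen q^' D.
  apply: pgroup_sub_pgen (subsetIl _ _) _.
  by apply: neq_pgroup npq _; apply: pgroupS pP; apply: subsetIr.
apply: subset_trans sDP (subset_trans (cent_comm_pconnected q defG cAB) _).
by rewrite centS // cycle_subG mem_pgen.
Qed.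

(** Suitable Sylow [p]-subgroups of [A] and [B] multiply to one of [G]. A conjugate of [a]
    normalises the first and, as a [p^']-element of [A], centralises the second. *)
Lemma Sylow_pq_action_mulG p q A B G P a :
    p != q -> A * B = G -> pconnected A B -> p.-Sylow(A) P -> pq_action p q A P a ->
  exists R : {group gT}, exists g, p.-Sylow(G) R /\ pq_action p q G R g.
Proof.
move=> npq defG cAB sylP [_ pP /setIP[Aa nPa] qa ncPa].
have [sAG sBG] := mulG_sub defG.
have [P1 [Q [R [sylP1 sylQ sylR sPR sQR]]]] := Sylow_mulG_sub p defG.
have [x Ax def_P] := Sylow_trans sylP sylP1.
have [sRG pR _] := and3P sylR; have sQB := pHall_sub sylQ.
exists R, (a ^ x); split=> //; split=> //; last 2 first.
- by rewrite p_eltJ.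
- apply: contra ncPa => cRax; rewrite -(memJ_conjg _ x) -centJ -def_P.
  exact: subsetP (centS sPR) _ cRax.
have Aax: a ^ x \in A by rewrite groupJ.
rewrite inE (subsetP sAG) //=.
(* By orders: [#|P1 :&: Q|] is at most the [p]-part of [#|A :&: B|], so [P1 * Q] is large enough to
   fill [R]. *)
have defR: P1 * Q = R.
  apply/eqP; rewrite eqEcard mul_subG //=.
  have ltAB: 0 < #|A * B| by rewrite defG.
  have pI: p.-group (P1 :&: Q) := pgroupS (subsetIl _ _) (pHall_pgroup sylP1).
  have leI: #|P1 :&: Q| <= #|A :&: B|`_p.
    rewrite dvdn_leq // -(part_pnat_id pI) partn_dvd ?cardSg //.
    by rewrite setISS ?(pHall_sub sylP1).
  rewrite -(leq_pmul2r (part_gt0 p #|A :&: B|)) (card_Hall sylR) -defG -partnM //.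
  rewrite -mul_cardG partnM // -(card_Hall sylP1) -(card_Hall sylQ) mul_cardG.
  by rewrite leq_mul2l leI orbT.
rewrite -defR; apply/normP; rewrite conjsMg.
have -> : P1 :^ (a ^ x) = P1.
  by apply/normP; rewrite def_P normJ memJ_conjg.
congr (_ * _); apply/normP.
have cax: a ^ x \in 'C(pgen p B).
  have [_ /subsetP c2] := cAB p; apply: c2; apply: mem_pgen => //.
  by rewrite p_eltJ; apply: sub_p_elt qa => r /eqP->; rewrite !inE eq_sym.
apply: subsetP (cent_sub _) _ _.
exact: subsetP (centS (pgroup_sub_pgen sQB (pHall_pgroup sylQ))) _ cax.
Qed.

End Actions.

(** * The subgroup governing the Hawkes graph *)

Section Residuals.
Variable gT : finGroupType.
Implicit Types (pi : nat_pred) (A B G H K N P R : {group gT}) (p q : nat).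

Lemma pgen_id pi G : pgen pi (pgen pi G) = pgen pi G.
Proof.
apply/eqP; rewrite eqEsubset pgen_sub; apply/pgen_subP=> x Gx pix.
by rewrite !mem_pgen.
Qed.

Lemma p'group_notin_pi p G : p^'.-group G = (p \notin \pi(G)).
Proof. by rewrite -partG_eq1 p_part_eq1. Qed.

(** Schur-Zassenhaus gives a complement [C], normal since [P] is central. As [R / C] is a [p]-group
    and [p^']-elements generate [R], all of [R] lies in [C]. *)
Lemma central_Sylow_pgen p P R :
    pgen p^' R = R -> p.-Sylow(R) P -> R \subset 'C(P) -> P :=: 1.
Proof.
move=> genR sylP cPR; have [sPR pP _] := and3P sylP.
have nsPR: P <| R by rewrite /normal sPR cents_norm.
have /splitsP[C /complP[tiPC defR]] := SchurZassenhaus_split (pHall_Hall sylP) nsPR.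
have [_ sCR] := mulG_sub defR.
have nCP: P \subset 'N(C) by rewrite cents_norm // centsC (subset_trans sCR).
have sRC: R \subset C.
  rewrite -genR; apply: pgen_sub_pquotient; first by rewrite -defR mul_subG ?normG.
  by rewrite -defR quotientMidr pgroupNK quotient_pgroup.
by apply/trivgP; rewrite -tiPC subsetI subxx (subset_trans sPR).
Qed.

End Residuals.

Lemma pgen_pgen_mulG (p q : nat) (gT : finGroupType) (A B G : {group gT}) :
    A * B = G -> pconnected A B -> p \in \pi(pgen p^' (pgen q G)) ->
  (p \in \pi(pgen p^' (pgen q A))) || (p \in \pi(pgen p^' (pgen q B))).
Proof.
move=> defG cAB; apply: contraLR; rewrite negb_or -!p'group_notin_pi => /andP[p'A p'B].
set R := pgen p^' (pgen q G); have [sAG sBG] := mulG_sub defG.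
have sRG: R \subset G by rewrite (subset_trans (pgen_sub _ _)) ?pgen_sub.
have [P sylP] := Sylow_exists p R; have [sPR pP _] := and3P sylP.
have sPG := subset_trans sPR sRG.
pose D := [~: A, B]%G; pose K := (A <*> D)%G; pose L := (B <*> D)%G.
have nsKG: K <| G by apply: joing_comm_normal.
have nsLG: L <| G.
  by rewrite /= commGC; apply: joing_comm_normal (mulg_comm defG).
(* [G / N] is an image of [X], so [R / N] is a [p^']-group and [P] vanishes in it. *)
have sP_normal (X Y N : {group gT}) :
    X * Y = G -> Y \subset N -> N <| G -> p^'.-group (pgen p^' (pgen q X)) ->
  P \subset N.
  move=> defXY sYN /andP[sNG nNG] p'X; have nNP := subset_trans sPG nNG.
  have [sXG _] := mulG_sub defXY; have nNX := subset_trans sXG nNG.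
  have eqXG: G / N = X / N.
    by rewrite -(mulG_supplement defXY sYN sNG) quotientMidr.
  have eqR: R / N = pgen p^' (pgen q X) / N.
    rewrite /R -!quotient_pgen ?(subset_trans (pgen_sub _ _)) //=.
    by rewrite eqXG.
  rewrite -quotient_sub1 // subG1 trivg_card1; apply/eqP/(@pnat_1 p).
    exact: quotient_pgroup.
  apply: (pgroupS (quotientS N sPR)).
  by rewrite /= eqR quotient_pgroup.
have sPK: P \subset K := sP_normal B A K (mulg_comm defG) (joing_subl _ _) nsKG p'B.
have sPL: P \subset L := sP_normal A B L defG (joing_subl _ _) nsLG p'A.
have nDG: G \subset 'N(D) by rewrite -defG mul_subG ?commg_norml ?commg_normr.
have [nDP nDR] := (subset_trans sPG nDG, subset_trans sRG nDG).
(* Modulo [D], [P] becomes a central Sylow subgroup of [R], hence trivial. *)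
have sPD: P \subset D.
  rewrite -quotient_sub1 // subG1; apply/eqP.
  have sylPD := quotient_pHall nDP sylP.
  have cPD: R / D \subset 'C(P / D).
    rewrite quotient_cents2 // commGC.
    apply: subset_trans (comm_joing_capI defG).
    by rewrite commgSS // subsetI sPK.
  have genRD: pgen p^' (R / D) = R / D by rewrite quotient_pgen // pgen_id.
  by have := central_Sylow_pgen genRD sylPD cPD.
(* For each prime [r] other than [p], [r]-elements centralise the [r^']-elements of [D], among them
   [P]. *)
have cPR: R \subset 'C(P).
  apply: pgen_sub_prime => r x r_pr p'r Gx rx.
  have sPpgenD: P \subset pgen r^' D.
    apply: pgroup_sub_pgen sPD _; apply: neq_pgroup pP.
    by rewrite eq_sym.
  have:= subset_trans sPpgenD (cent_comm_pconnected r defG cAB).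
  rewrite centsC => /subsetP; apply.
  by apply: mem_pgen rx; apply: subsetP Gx; apply: pgen_sub.
have P1: P :=: 1 by apply: central_Sylow_pgen sylP cPR; apply: pgen_id.
by rewrite -partG_eq1 -(card_Hall sylP) P1 cards1.
Qed.


(** * Edges as failures of centralisation *)

Lemma notin_pi_quotient (gT : finGroupType) (q : nat) (G K : {group gT}) :
  G \subset 'N(K) -> (q \notin \pi(G / K)) = (pgen q G \subset K).
Proof.
move=> nKG; rewrite -p'group_notin_pi; apply/idP/idP.
  exact: pgen_sub_pquotient.
exact: pquotient_pgen.
Qed.

(** There is no edge exactly when [pgen q G] lies in ['O_{p^', p}(G)], that is, when this normal
    subgroup is [p]-nilpotent: its [p^']-elements generate a [p^']-group. *)
Lemma hawkes_edge (gT : finGroupType) (p q : nat) (G : {group gT}) :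
  edge (hawkes_graph G) p q <-> p \in \pi(pgen p^' (pgen q G)).
Proof.
set K := 'O_{p^', p}(G); set O := 'O_p^'(G).
have [sMG nMG] := andP (pgen_normal q G).
have nOG: G \subset 'N(O) by apply: gFnorm.
have sOK: O \subset K by rewrite /O -pseries1 (pseries_sub_catl [:: _] [:: _]).
have quoK: K / O = 'O_p(G / O) := quotient_pseries2 _ _ _.
have sKG: K \subset G by apply: gFsub.
have nOM := subset_trans sMG nOG.
have eqK: (pgen q G \subset K) = p^'.-group (pgen p^' (pgen q G)).
  apply/idP/idP=> [sMK | p'R].
    apply: pgroupS (pcore_pgroup p^' G).
    apply: subset_trans (pgenS _ sMK) _.
    apply: pgen_sub_pquotient; first exact: subset_trans nOG.
    by rewrite pgroupNK [X in p.-group X]quoK pcore_pgroup.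
  rewrite -(quotientSGK nOM sOK) quoK pcore_max ?quotient_normal ?pgen_normal //.
  rewrite -pgroupNK pquotient_pgen // pcore_max // /normal.
  by rewrite (subset_trans (pgen_sub _ _)) //= !norms_pgen ?normG.
split=> [[pG qGK] | pR].
  apply: contraLR qGK; rewrite -p'group_notin_pi -eqK => sMK.
  by rewrite notin_pi_quotient ?gFnorm.
split; first by apply: piSg pR; rewrite (subset_trans (pgen_sub _ _)).
apply: contraLR pR; rewrite notin_pi_quotient ?gFnorm //.
by rewrite -p'group_notin_pi -eqK.
Qed.

(** [P <*> 'C_G(P)] is a [p]-group modulo ['C_G(P)], so for [q != p] its [q]-elements centralise
    [P]. *)
Lemma sylow_edge (gT : finGroupType) (p q : nat) (G : {group gT}) :
  edge (sylow_graph G) p q <->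
  p != q /\ exists P : {group gT}, exists g, p.-Sylow(G) P /\ pq_action p q G P g.
Proof.
split=> [[_ [P [+ piq]]] | [npq [P [g [sylP [sPG pP Ng qg ncPg]]]]]].
  rewrite inE => sylP; have [sPG pP _] := and3P sylP.
  have nPC: 'N_G(P) \subset 'N(P <*> 'C_G(P)).
    by rewrite normsY ?subsetIr ?normal_norm ?subcent_normal.
  have := piq; rewrite -[_ \in _]negbK notin_pi_quotient // => /pgen_subP nsub.
  have [/existsP[g] | /existsPn none] :=
    boolP [exists g in 'N_G(P), q.-elt g && (g \notin P <*> 'C_G(P))]; last first.
    case: nsub => g Ng qg; apply: contraR (none g) => ng.
    by rewrite Ng qg ng.
  case/and3P=> Ng qg nPCg; have [Gg nPg] := setIP Ng.
  (* No loops: [P] is a normal Sylow subgroup of ['N_G(P)] and contains all [p]-elements there. *)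
  have npq: p != q.
    apply: contra nPCg => /eqP eq_pq; rewrite mem_gen // inE.
    have sPN: P \subset 'N_G(P) by rewrite subsetI sPG normG.
    have sylN := pHall_subl sPN (subsetIl _ _) sylP.
    by rewrite (mem_normal_Hall sylN (normalSG sPG) Ng) eq_pq qg.
  split=> //; exists P, g; split=> //; split=> //.
  by apply: contra nPCg => cPg; rewrite mem_gen // !inE Gg cPg orbT.
have [Gg nPg] := setIP Ng.
have sP_PC : P \subset P <*> 'C_G(P) by apply: joing_subl.
split.
  apply: contraR ncPg => np.
  have p'P: p^'.-group P by apply: pgroupS sPG _; rewrite p'group_notin_pi.
  have /eqP: #|P| == 1%N by apply/eqP/(pnat_1 pP p'P).
  by move/card1_trivg->; rewrite cent1T inE.
exists P; rewrite inE; split=> //; apply: contraR ncPg.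
have nPC: 'N_G(P) \subset 'N(P <*> 'C_G(P)).
  by rewrite normsY ?subsetIr ?normal_norm ?subcent_normal.
rewrite notin_pi_quotient // => sub.
have PCg : g \in P <*> 'C_G(P) by apply: (subsetP sub); apply: mem_pgen.
have cPC: P \subset 'N('C_G(P)).
  apply: subset_trans (normal_norm (subcent_normal G P)).
  by rewrite subsetI sPG normG.
have cCP: P <*> 'C_G(P) \subset 'N('C_G(P)).
  by rewrite join_subG normG cPC.
suffices: pgen q (P <*> 'C_G(P)) \subset 'C_G(P).
  move/subsetP/(_ g)/(_ (mem_pgen PCg qg)); by case/setIP.
apply: pgen_sub_pquotient => //.
rewrite quotientYidr //.
apply: quotient_pgroup; exact: neq_pgroup pP.
Qed.

(** In a Schmidt group, [P] centralised by a Sylow [q]-subgroup [Q] would make [S = P * Q]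
    nilpotent. Conversely, a minimal non-nilpotent subgroup of [P <*> <[g]>] is the required Schmidt
    group. *)
Lemma ncrit_edge (gT : finGroupType) (p q : nat) (G : {group gT}) :
  edge (ncrit_graph G) p q <->
  p != q /\ exists P : {group gT}, exists g, pq_action p q G P g.
Proof.
split=> [[S [sSG [[nnS minS] [piS [P [+ nsPS]]]]]] | [npq [P [g [sPG pP Ng qg ncPg]]]]].
  rewrite inE => sylP; have [sPS pP _] := and3P sylP.
  have pqS r : r \in \pi(S) -> (r == p) || (r == q).
    by case/piS=> ->; rewrite eqxx ?orbT.
  have npq: p != q.
    apply: contra nnS => /eqP eq_pq; apply: (@pgroup_nil _ p).
    apply/pgroupP=> r r_pr rS; rewrite inE.
    have := pqS r; rewrite mem_primes r_pr cardG_gt0 rS -eq_pq orbb.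
    exact.
  split=> //; exists P.
  have [/existsP[g /and3P[Sg qg ncPg]] | /existsPn none] :=
    boolP [exists g in S, q.-elt g && (g \notin 'C(P))].
    exists g; split; rewrite ?(subset_trans sPS) // inE (subsetP sSG) //.
    by rewrite (subsetP (normal_norm nsPS)).
  have [Q sylQ] := Sylow_exists q S; have [sQS qQ _] := and3P sylQ.
  have cPQ: Q \subset 'C(P).
    apply/subsetP=> x Qx; apply: contraR (none x) => ncx.
    by rewrite (subsetP sQS) // (mem_p_elt qQ).
  have co_PQ: coprime #|P| #|Q|.
    by apply: (pnat_coprime pP); apply: neq_pgroup qQ; rewrite eq_sym.
  case/negP: nnS; suffices <-: P * Q = S.
    by rewrite mulg_nil // (pgroup_nil pP) (pgroup_nil qQ).
  apply/eqP; rewrite eqEcard mul_subG // coprime_cardMg //.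
  rewrite (card_Hall sylP) (card_Hall sylQ) -{1}(partnC p (cardG_gt0 S)).
  rewrite leq_mul2l; apply/orP; right.
  rewrite (@eq_in_partn p^' q) // => r piSr; rewrite !inE.
  by case/orP: (pqS r piSr) => /eqP->; rewrite eqxx ?(negPf npq) // eq_sym npq.
have [Gg nPg] := setIP Ng; pose H := (P <*> <[g]>)%G.
have nP_g : <[g]> \subset 'N(P) by rewrite cycle_subG.
have nnH: ~~ nilpotent H.
  apply: contra ncPg => nilH; rewrite -cycle_subG.
  apply: (sub_nilpotent_cent2 nilH); rewrite ?joing_subl ?joing_subr //.
  by apply: (pnat_coprime pP); apply: (@neq_pgroup _ q) qg; rewrite eq_sym.
have nilp (r : nat) (X : {group gT}) : r.-group X -> nilpotent X := @pgroup_nil _ _ _.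
pose notnil := [pred X : {group gT} | ~~ nilpotent X].
have [S /mingroupP[/= nnS minS] sSH] := @mingroup_exists _ notnil H nnH.
have sHG: H \subset G by rewrite join_subG sPG cycle_subG.
have sylPH: p.-Sylow(H) P.
  apply/and3P; split=> //; first exact: joing_subl.
  rewrite -card_quotient ?join_subG ?normG // quotientYidl //.
  by apply: quotient_pgroup; apply: (@neq_pgroup _ q) qg; rewrite eq_sym.
have nsPH: P <| H by rewrite /normal joing_subl join_subG normG.
pose pq : nat_pred := [pred r : nat | (r == p) || (r == q)].
have pqH : pq.-group H.
  rewrite /H /= norm_joinEr // pgroupM; apply/andP; split.
    by apply: sub_pgroup pP => r /eqP->; rewrite !inE eqxx.
  by apply: sub_p_elt qg => r /eqP->; rewrite !inE eqxx orbT.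
have pqS r : r \in \pi(S) -> (r == p) || (r == q).
  exact: pnatPpi (pgroupS sSH pqH).
(* Both primes occur in [S], which would otherwise be an [r]-group and nilpotent. *)
have both (r s : nat) :
    (forall t, t \in \pi(S) -> (t == r) || (t == s)) -> s \in \pi(S).
  move=> rsS; apply: contraR nnS => nsS; apply: (nilp r).
  apply/pgroupP=> t t_pr tS; have St: t \in \pi(S) by rewrite mem_primes t_pr cardG_gt0.
  by case/orP: (rsS t St) => // /eqP def_t; rewrite def_t (negPf nsS) in St.
exists S; split; first exact: subset_trans sHG.
split.
  split=> // X /andP[sXS nsSX]; apply: contraR nsSX => nnX.
  by rewrite (minS X).
split.
  move=> r; split=> [/pqS/orP[]/eqP-> | ]; [by left | by right | case=> ->].
    by apply: (both q p) => t /pqS; rewrite orbC.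
  exact: both pqS.
exists (P :&: S)%G; rewrite inE (setI_normal_Hall nsPH) //.
by rewrite /normal subsetIr normsI ?normG // (subset_trans sSH) ?normal_norm.
Qed.

(** * Vertices and edges for two factors *)

Lemma pi_mulG (gT : finGroupType) (p : nat) (A B G : {group gT}) :
  A * B = G -> p \in \pi(G) <-> p \in \pi(A) \/ p \in \pi(B).
Proof.
move=> defG; have ->: (p \in \pi(G)) = (p \in \pi(A)) || (p \in \pi(B)).
  apply: negb_inj; rewrite negb_or -!p'group_notin_pi -defG.
  exact: pgroupM.
by split=> /orP.
Qed.

Section Edges.
Variables (gT : finGroupType) (p q : nat).
Implicit Types A B G P : {group gT}.

Lemma sylow_edge_mulG A B G :
    A * B = G -> pconnected A B ->
  edge (sylow_graph G) p q <->
  edge (sylow_graph A) p q \/ edge (sylow_graph B) p q.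
Proof.
move=> defG cAB; have [cBA defG'] := (pconnected_sym cAB, mulg_comm defG).
split=> [/sylow_edge[npq [P [g [sylP actPg]]]] | []].
- have [P1 [g1 [] [actPg1 /(_ sylP) sylP1]]] := pq_action_mulG npq defG cAB actPg.
    by left; apply/sylow_edge; split=> //; exists P1, g1.
  by right; apply/sylow_edge; split=> //; exists P1, g1.
- case/sylow_edge=> npq [P [g [sylP actPg]]]; apply/sylow_edge; split=> //.
  exact: Sylow_pq_action_mulG defG cAB sylP actPg.
case/sylow_edge=> npq [P [g [sylP actPg]]]; apply/sylow_edge; split=> //.
exact: Sylow_pq_action_mulG defG' cBA sylP actPg.
Qed.

Lemma ncrit_edge_mulG A B G :
    A * B = G -> pconnected A B ->
  edge (ncrit_graph G) p q <->
  edge (ncrit_graph A) p q \/ edge (ncrit_graph B) p q.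
Proof.
move=> defG cAB; have [sAG sBG] := mulG_sub defG.
split=> [| [] [S [sS schS]]]; last 2 first.
- by exists S; rewrite (subset_trans sS).
- by exists S; rewrite (subset_trans sS).
case/ncrit_edge=> npq [P [g actPg]].
have [P1 [g1 [] [actPg1 _]]] := pq_action_mulG npq defG cAB actPg.
  by left; apply/ncrit_edge; split=> //; exists P1, g1.
by right; apply/ncrit_edge; split=> //; exists P1, g1.
Qed.

Lemma hawkes_edge_mulG A B G :
    A * B = G -> pconnected A B ->
  edge (hawkes_graph G) p q <->
  edge (hawkes_graph A) p q \/ edge (hawkes_graph B) p q.
Proof.
move=> defG cAB; have [sAG sBG] := mulG_sub defG.
(* Read through [hawkes_edge], edges pass to overgroups because [pgen] is monotone. *)
have edgeS (X : {group gT}) :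
    X \subset G -> edge (hawkes_graph X) p q -> edge (hawkes_graph G) p q.
  by move=> sXG /hawkes_edge pX; apply/hawkes_edge; apply: piSg pX; apply/pgenS/pgenS.
split=> [/hawkes_edge/(pgen_pgen_mulG defG cAB)/orP | []]; try exact: edgeS.
by case=> pR; [left | right]; apply/hawkes_edge.
Qed.

End Edges.

(** * Induction on the number of factors *)

(** The property [Q] stands for a vertex or an edge of any of the three graphs. The clause on [C]
    strengthens the induction: it makes the partial product connected to the next factor. *)
Lemma prod_pconnected (gT : finGroupType) (Q : {group gT} -> Prop) n
    (Gs : 'I_n -> {group gT}) :
    ~ Q 1%G ->
    (forall A B G : {group gT}, A * B = G -> pconnected A B -> Q G <-> Q A \/ Q B) ->
    (forall i j, (Gs i : {set gT}) * Gs j = (Gs j : {set gT}) * Gs i) ->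
    (forall i j, i != j -> pconnected (Gs i) (Gs j)) ->
  exists2 H : {group gT}, H :=: \prod_(i < n) (Gs i : {set gT})
    & (forall C : {group gT}, (forall i, pconnected (Gs i) C) -> pconnected H C)
      /\ (Q H <-> exists i, Q (Gs i)).
Proof.
move=> Q1 QM; elim: n => [|n IHn] in Gs * => comG conG.
  exists 1%G; first by rewrite big_ord0.
  split=> [C _ p1 | ]; last by split=> [/Q1 | [[]]].
  by split; apply: subset_trans (pgen_sub _ _) (sub1G _).
pose Gs' (i : 'I_n) := Gs (widen_ord (leqnSn n) i).
have [||H0 defH0 [conH0 QH0]] := IHn Gs'.
- by move=> i j; apply: comG.
- by move=> i j nij; apply: conG.
pose B := Gs ord_max.
have comHB: commute H0 B.
  rewrite defH0 /commute; elim/big_ind: _ => [|X Y cX cY|i _].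
  - by rewrite mul1g mulg1.
  - by rewrite -mulgA cY !mulgA cX.
  exact: comG.
have defH: H0 * B = (H0 <*> B)%G by rewrite /= comm_joingE.
have conHB: pconnected H0 B.
  by apply: conH0 => i; apply: conG; rewrite -val_eqE /= neq_ltn ltn_ord.
exists (H0 <*> B)%G; first by rewrite -defH defH0 big_ord_recr.
split=> [C conC | ].
  apply: (pconnected_mul defH conHB); last exact: conC.
  by apply: conH0 => i; apply: conC.
have QH := QM _ _ _ defH conHB; split=> [/QH[/QH0[i Qi] | QB] | [i Qi]].
- by exists (widen_ord (leqnSn n) i).
- by exists ord_max.
apply/QH; have [lt_in | ge_in] := ltnP i n.
  left; apply/QH0; exists (Ordinal lt_in).
  by rewrite /Gs' (_ : widen_ord _ _ = i) //; apply: val_inj.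
right; rewrite /B (_ : ord_max = i) //; apply: val_inj; apply/eqP.
by rewrite eqn_leq ge_in -ltnS ltn_ord.
Qed.

Theorem theorem1 (gT : finGroupType) (G : {group gT}) (n : nat)
    (Gs : 'I_n -> {group gT}) :
  (forall i, Gs i \subset G) ->
  G :=: \prod_(i < n) (Gs i : {set gT}) ->
  (forall i j, (Gs i : {set gT}) * Gs j = (Gs j : {set gT}) * Gs i) ->
  (forall i j, i != j -> N_connected (Gs i) (Gs j)) ->
  graph_eq (sylow_graph G) (graph_bigU (fun i => sylow_graph (Gs i))) /\
  graph_eq (hawkes_graph G) (graph_bigU (fun i => hawkes_graph (Gs i))) /\
  graph_eq (ncrit_graph G) (graph_bigU (fun i => ncrit_graph (Gs i))).
Proof.
move=> _ defG comG conG.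
have prodQ (Q : {group gT} -> Prop) :
    ~ Q 1%G ->
    (forall A B H : {group gT},
       A * B = H -> pconnected A B -> Q H <-> Q A \/ Q B) ->
  Q G <-> exists i, Q (Gs i).
  move=> Q1 QM; have [|H defH [_]] := prod_pconnected Q1 QM comG.
    by move=> i j nij; apply/N_connected_pconnected/conG.
  by suffices ->: G = H by []; apply/group_inj; rewrite defG.
have pi1 p : ~ p \in \pi(1%G : {group gT}) by rewrite /= cards1.
have vertQ p : p \in \pi(G) <-> exists i, p \in \pi(Gs i).
  by apply: (prodQ (fun H => p \in \pi(H))) => // A B H defH _; apply: pi_mulG.
split; [|split]; split=> // p q.
- apply: (prodQ (fun H => edge (sylow_graph H) p q)) => [[/pi1 //] | A B H].
  exact: sylow_edge_mulG.
- apply: (prodQ (fun H => edge (hawkes_graph H) p q)) => [[/pi1 //] | A B H].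
  exact: hawkes_edge_mulG.
apply: (prodQ (fun H => edge (ncrit_graph H) p q)) => [|A B H].
  by case/ncrit_edge=> _ [P [g [_ _ /setIP[/set1P-> _] _]]]; rewrite group1.
exact: ncrit_edge_mulG.
Qed.
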